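(* Let $n\ge 1$ and let $S$ be a set of $2n$ points in $\mathbb R^2$. Let $\{a_ib_i : i=1,\dots,n\}$ be a max-sum matching of $S$. Then there exists a point $o\in\mathbb R^2$ such that \[ \|a_i-o\|+\|b_i-o\|\le \frac{2}{\sqrt3}\,\|a_i-b_i\| \quad\text{for all } i=1,\dots,n. \] Equivalently, $\bigcap_{i=1}^n \mathcal E(a_ib_i)\neq\emptyset$.
   Context: $\|\cdot\|$ is the Euclidean norm. For an even finite set $S\subset\mathbb R^2$, a perfect matching $\mathcal M$ of $S$ is a partition of $S$ into unordered pairs (edges); its cost is $\sum_{ab\in\mathcal M}\|a-b\|$. A max-sum matching of $S$ is a perfect matching of $S$ of maximum cost. For points $a,b\in\mathbb R^2$, $\mathcal E(ab)=\{x\in\mathbb R^2: \|a-x\|+\|b-x\|\le \tfrac{2}{\sqrt3}\|a-b\|\}$. *)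

(* Defs.v *)
From Stdlib Require Export Reals Lra List Permutation.
Export ListNotations.
Open Scope R_scope.

Definition pt : Type := (R * R)%type.

Definition edist (a b : pt) : R :=
  sqrt ((fst a - fst b) ^ 2 + (snd a - snd b) ^ 2).

(* A perfect matching of the finite set S (given as a duplicate-free list)
   is a list of unordered pairs (edges) whose endpoints, listed together,
   form exactly S (each point used exactly once). *)
Definition endpoints (M : list (pt * pt)) : list pt :=
  flat_map (fun e => [fst e; snd e]) M.

Definition is_perfect_matching (S : list pt) (M : list (pt * pt)) : Prop :=
  Permutation (endpoints M) S.

Definition cost (M : list (pt * pt)) : R :=
  fold_right Rplus 0 (map (fun e => edist (fst e) (snd e)) M).

Definition is_max_sum_matching (S : list pt) (M : list (pt * pt)) : Prop :=
  is_perfect_matching S M /\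
  forall M', is_perfect_matching S M' -> cost M' <= cost M.

Definition ellE (a b x : pt) : Prop :=
  edist a x + edist b x <= 2 / sqrt 3 * edist a b.

(* Main.v *)
Require Import Defs.
From Stdlib Require Import Reals List Permutation.
From Stdlib Require Import Psatz Bool PeanoNat Lia ListDec Classical_Prop ClassicalEpsilon.
Open Scope R_scope.

(** One finds radii [y p >= 0] such that the disks of centre [p] and radius [y p]
    ([p] in [S]) meet pairwise and are tangent along the edges of the matching.
    Pairwise meeting disks acquire a common point [o] once their radii are
    multiplied by [2 / sqrt 3], and adding the two inequalities at the ends of an
    edge [ab], where [y a + y b = |ab|], gives the theorem.

    By linear programming duality the radii exist as soon as no family of cycles
    covering [S] (loops allowed) has total length above twice the cost of the
    matching.  An even cycle is the union of two matchings, so it suffices to merge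
    two odd cycles into an even one without loss of length.  Merging along an edge
    [e] of the first and an edge [f] of the second loses nothing if [e] and [f] are
    opposite sides of a convex quadrilateral, since the diagonals are then at least
    as long.  In general position, the pairs [(e, f)] that are not of this kind are
    counted modulo 2 by a sum that telescopes along both cycles, so their number is
    even, whereas the number of all pairs is odd. *)

(** * Opposite sides of a convex quadrilateral *)

Definition orient (a b c : pt) : R :=
  (fst b - fst a) * (snd c - snd a) - (snd b - snd a) * (fst c - fst a).

Definition ltb (x y : R) : bool := if Rlt_dec x y then true else false.

Definition above (e : pt * pt) (q : pt) : bool :=
  ltb 0 (orient (fst e) (snd e) q * (fst (snd e) - fst (fst e))).
Definition between (e : pt * pt) (q : pt) : bool :=
  ltb ((fst q - fst (fst e)) * (fst q - fst (snd e))) 0.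

(* [e] and [f] cross iff the number of ends of either one lying over or under the other
   (ends of [f] above [e], ends of [e] below [f]) is odd: this is how the crossing
   number of two closed polygons telescopes.  Adding, modulo 2, the ends separated by
   the lines of [e] and [f] turns "[e] and [f] cross" into "[e] and [f] are not opposite
   sides of a convex quadrilateral"; side1 and side2 are the resulting summands. *)
Definition side1 (e : pt * pt) (q : pt) : bool := above e q && negb (between e q).
Definition side2 (e : pt * pt) (q : pt) : bool := above e q || between e q.

(** [a], [b] and [c], [d] are the abscissas of the ends of two segments; [o1], [o2] are the
    orientations of the ends of the second relative to the first, [o3], [o4] the converse. The two
    equations are the affine dependence of the four ends; they refute every even-parity pattern of
    signs and orders that violates the conclusion. *)
Lemma opposite_sides_scalar (a b c d o1 o2 o3 o4 : R) :
  a < b -> c < d -> a <> c -> a <> d -> b <> c -> b <> d ->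
  o1 <> 0 -> o2 <> 0 -> o3 <> 0 -> o4 <> 0 ->
  o4 + o2 = o3 + o1 -> o4 * a + o2 * c = o3 * b + o1 * d ->
  xorb (xorb (ltb 0 o1 && negb (ltb a c && ltb c b))
             (ltb 0 o2 && negb (ltb a d && ltb d b)))
       (xorb (ltb 0 o3 || (ltb c a && ltb a d))
             (ltb 0 o4 || (ltb c b && ltb b d))) = false ->
  0 < o1 * o2 /\ 0 < o3 * o4.
Proof.
  intros Hab Hcd Hac Had Hbc Hbd H1 H2 H3 H4 E1 E2.
  unfold ltb.
  destruct (Rlt_dec 0 o1), (Rlt_dec 0 o2), (Rlt_dec 0 o3), (Rlt_dec 0 o4);
  destruct (Rlt_dec a c), (Rlt_dec c a); try lra;
  destruct (Rlt_dec a d), (Rlt_dec d a); try lra;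
  destruct (Rlt_dec b c), (Rlt_dec c b); try lra;
  destruct (Rlt_dec b d), (Rlt_dec d b); try lra;
  simpl; intros HH; try discriminate HH;
  try (split; nra); exfalso; try nra.
Qed.

Lemma ltb_pos_mulr x y : 0 < y -> ltb 0 (x * y) = ltb 0 x.
Proof.
  intros Hy; unfold ltb; destruct (Rlt_dec 0 (x * y)), (Rlt_dec 0 x); auto; nra.
Qed.

Lemma ltb_between a b c : a < b ->
  ltb ((c - a) * (c - b)) 0 = ltb a c && ltb c b.
Proof.
  intros Hy; unfold ltb.
  destruct (Rlt_dec ((c - a) * (c - b)) 0), (Rlt_dec a c), (Rlt_dec c b); auto; nra.
Qed.

Lemma orient_swap a b c : orient b a c = - orient a b c.
Proof. unfold orient; ring. Qed.

Lemma above_swap a b q : above (b, a) q = above (a, b) q.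
Proof. unfold above; simpl; rewrite orient_swap; f_equal; ring. Qed.

Lemma between_swap a b q : between (b, a) q = between (a, b) q.
Proof. unfold between; simpl; f_equal; ring. Qed.

(** Excludes the ties on which the strict tests in [above] and [between] would be decided
    arbitrarily. *)
Definition generic_pair (e f : pt * pt) : Prop :=
  fst (fst e) <> fst (snd e) /\ fst (fst f) <> fst (snd f) /\
  (fst (fst e) <> fst (fst f) /\ fst (fst e) <> fst (snd f) /\
   fst (snd e) <> fst (fst f) /\ fst (snd e) <> fst (snd f)) /\
  orient (fst e) (snd e) (fst f) <> 0 /\ orient (fst e) (snd e) (snd f) <> 0 /\
  orient (fst f) (snd f) (fst e) <> 0 /\ orient (fst f) (snd f) (snd e) <> 0.

(** Neither line separates the ends of the other segment. This excludes crossing segments as well as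
    an end inside the triangle of the other three. *)
Definition opposite_sides (e f : pt * pt) : Prop :=
  0 < orient (fst e) (snd e) (fst f) * orient (fst e) (snd e) (snd f) /\
  0 < orient (fst f) (snd f) (fst e) * orient (fst f) (snd f) (snd e).

Definition pair_parity (e f : pt * pt) : bool :=
  xorb (xorb (side1 e (fst f)) (side1 e (snd f)))
       (xorb (side2 f (fst e)) (side2 f (snd e))).

Lemma pair_parity_opposite_sides_sorted p p' q q' :
  fst p < fst p' -> fst q < fst q' ->
  generic_pair (p, p') (q, q') -> pair_parity (p, p') (q, q') = false ->
  opposite_sides (p, p') (q, q').
Proof.
  unfold generic_pair, opposite_sides, pair_parity, side1, side2, above, between.
  simpl; intros Hp Hq (_ & _ & (H1 & H2 & H3 & H4) & H5 & H6 & H7 & H8).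
  rewrite !ltb_pos_mulr, !ltb_between by lra.
  apply opposite_sides_scalar; auto; unfold orient; ring.
Qed.

(** Reversing an edge changes none of the three notions, so both edges may be taken to run from left
    to right. *)
Lemma pair_parity_opposite_sides e f :
  generic_pair e f -> pair_parity e f = false -> opposite_sides e f.
Proof.
  destruct e as [p p'], f as [q q'].
  assert (Hl : forall a b g, generic_pair (a, b) g -> generic_pair (b, a) g).
  { intros a b [c d]; unfold generic_pair; simpl.
    rewrite !(orient_swap a b); intuition lra. }
  assert (Hr : forall a b g, generic_pair g (a, b) -> generic_pair g (b, a)).
  { intros a b [c d]; unfold generic_pair; simpl.
    rewrite !(orient_swap a b); intuition lra. }
  assert (Pl : forall a b g, pair_parity (b, a) g = pair_parity (a, b) g).
  { intros a b g; unfold pair_parity, side1, side2; simpl.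
    rewrite !(above_swap a b), !(between_swap a b).
    f_equal; apply xorb_comm. }
  assert (Pr : forall a b g, pair_parity g (b, a) = pair_parity g (a, b)).
  { intros a b g; unfold pair_parity, side1, side2; simpl.
    rewrite !(above_swap a b), !(between_swap a b).
    f_equal; apply xorb_comm. }
  assert (Ol : forall a b g, opposite_sides (b, a) g -> opposite_sides (a, b) g).
  { intros a b g; unfold opposite_sides; simpl; rewrite !(orient_swap a b).
    intros [? ?]; split; lra. }
  assert (Or : forall a b g, opposite_sides g (b, a) -> opposite_sides g (a, b)).
  { intros a b g; unfold opposite_sides; simpl; rewrite !(orient_swap a b).
    intros [? ?]; split; lra. }
  intros G P.
  destruct (Rlt_le_dec (fst p) (fst p')) as [Hp|Hp];
  destruct (Rlt_le_dec (fst q) (fst q')) as [Hq|Hq].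
  - now apply pair_parity_opposite_sides_sorted.
  - apply Or, pair_parity_opposite_sides_sorted; auto.
    + destruct G as (_ & G & _); simpl in G; lra.
    + now rewrite Pr.
  - apply Ol, pair_parity_opposite_sides_sorted; auto.
    + destruct G as (G & _); simpl in G; lra.
    + now rewrite Pl.
  - apply Ol, Or, pair_parity_opposite_sides_sorted; auto.
    + destruct G as (G & _); simpl in G; lra.
    + destruct G as (_ & G & _); simpl in G; lra.
    + now rewrite Pr, Pl.
Qed.

(** * Euclidean distance and the diagonals of a quadrilateral *)

Lemma edist_sym a b : edist a b = edist b a.
Proof. unfold edist; f_equal; ring. Qed.

Lemma edist_pos a b : 0 <= edist a b.
Proof. apply sqrt_pos. Qed.

Lemma edist_refl a : edist a a = 0.
Proof.
  unfold edist; rewrite !Rminus_diag; replace (0 ^ 2 + 0 ^ 2) with 0 by ring.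
  apply sqrt_0.
Qed.

Lemma edist_sqr a b : edist a b ^ 2 = (fst a - fst b) ^ 2 + (snd a - snd b) ^ 2.
Proof. apply pow2_sqrt, Rplus_le_le_0_compat; apply pow2_ge_0. Qed.

Lemma edist_triangle a b c : edist a c <= edist a b + edist b c.
Proof.
  assert (H : forall u v, edist u v = dist_euc (fst u) (snd u) (fst v) (snd v)).
  { intros u v; unfold edist, dist_euc; f_equal; unfold Rsqr; ring. }
  rewrite !H; apply triangle.
Qed.

(* Both diagonals pass through the common point z of the two segments. *)
Lemma diagonals_ge (a b c d : pt) (al be ga de : R) :
  0 < al -> 0 < be -> 0 < ga -> 0 < de -> al + be = ga + de ->
  al * fst a + be * fst b = ga * fst c + de * fst d ->
  al * snd a + be * snd b = ga * snd c + de * snd d ->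
  edist a c + edist b d <= edist a b + edist c d.
Proof.
  intros Ha Hb Hc Hd E Ex Ey.
  set (s := al + be).
  set (z := ((al * fst a + be * fst b) / s, (al * snd a + be * snd b) / s) : pt).
  assert (seg : forall (u v : pt) k l, 0 < k -> 0 < l -> k + l = s ->
      k * fst u + l * fst v = s * fst z -> k * snd u + l * snd v = s * snd z ->
      edist u z + edist v z = edist u v).
  { intros u v k l Hk Hl Hs Hx Hy.
    assert (s <> 0) by lra.
    assert (U : edist u z = l / s * edist u v).
    { apply Rsqr_inj; [apply edist_pos | |].
      - apply Rmult_le_pos; [|apply edist_pos]. apply Rlt_le, Rdiv_lt_0_compat; lra.
      - rewrite !Rsqr_pow2, Rpow_mult_distr, !edist_sqr.
        replace (fst z) with ((k * fst u + l * fst v) / s) by (rewrite Hx; field; auto).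
        replace (snd z) with ((k * snd u + l * snd v) / s) by (rewrite Hy; field; auto).
        rewrite <- Hs; field; lra. }
    assert (V : edist v z = k / s * edist u v).
    { apply Rsqr_inj; [apply edist_pos | |].
      - apply Rmult_le_pos; [|apply edist_pos]. apply Rlt_le, Rdiv_lt_0_compat; lra.
      - rewrite !Rsqr_pow2, Rpow_mult_distr, !edist_sqr.
        replace (fst z) with ((k * fst u + l * fst v) / s) by (rewrite Hx; field; auto).
        replace (snd z) with ((k * snd u + l * snd v) / s) by (rewrite Hy; field; auto).
        rewrite <- Hs; field; lra. }
    rewrite U, V, <- Hs; field; lra. }
  assert (Hs : s <> 0) by (unfold s; lra).
  assert (S1 := seg a b al be Ha Hb eq_refl).
  assert (S2 := seg c d ga de Hc Hd (eq_sym E)).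
  simpl in S1, S2.
  rewrite <- S1 by (unfold z; simpl; field; auto).
  rewrite <- S2 by (unfold z; simpl; field_simplify; lra).
  pose proof (edist_triangle a z c); pose proof (edist_triangle b z d).
  rewrite (edist_sym z c) in *; rewrite (edist_sym z d) in *; lra.
Qed.

(** The four orientations are the coefficients of the affine dependence of the ends. Their signs
    tell which two connecting segments cross, that is, which are the diagonals. *)
Lemma opposite_sides_edist p p' q q' :
  opposite_sides (p, p') (q, q') ->
  edist p p' + edist q q' <= edist p q + edist p' q' \/
  edist p p' + edist q q' <= edist p q' + edist p' q.
Proof.
  unfold opposite_sides; simpl.
  set (o1 := orient p p' q); set (o2 := orient p p' q').
  set (o3 := orient q q' p); set (o4 := orient q q' p'); intros [H1 H2].
  assert (E0 : o4 + o2 = o3 + o1) by (unfold o1, o2, o3, o4, orient; ring).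
  assert (Ex : o4 * fst p + o2 * fst q = o3 * fst p' + o1 * fst q')
    by (unfold o1, o2, o3, o4, orient; ring).
  assert (Ey : o4 * snd p + o2 * snd q = o3 * snd p' + o1 * snd q')
    by (unfold o1, o2, o3, o4, orient; ring).
  clearbody o1 o2 o3 o4.
  assert (o1 <> 0) by nra. assert (o3 <> 0) by nra.
  rewrite (edist_sym p' q).
  destruct (Rlt_le_dec 0 o1), (Rlt_le_dec 0 o3); [left | right | right | left].
  - apply (diagonals_ge p q p' q' o4 o2 o3 o1); nra.
  - pose proof (diagonals_ge q p' q' p o2 (- o3) o1 (- o4)) as D.
    rewrite (edist_sym p' p), (edist_sym q' p) in D.
    enough (edist q q' + edist p p' <= edist q p' + edist p q') by lra.
    apply D; nra.
  - pose proof (diagonals_ge q p' q' p (- o2) o3 (- o1) o4) as D.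
    rewrite (edist_sym p' p), (edist_sym q' p) in D.
    enough (edist q q' + edist p p' <= edist q p' + edist p q') by lra.
    apply D; nra.
  - apply (diagonals_ge p q p' q' (- o4) (- o2) (- o3) (- o1)); nra.
Qed.

(** * Exchanging edges of two odd cycles *)

Fixpoint path_edges {A} (a : A) (l : list A) : list (A * A) :=
  match l with
  | [] => []
  | b :: l' => (a, b) :: path_edges b l'
  end.

(** A single vertex yields a loop and two vertices yield their edge in both directions, so a cycle
    always has as many edges as vertices. *)
Definition cycle_edges {A} (l : list A) : list (A * A) :=
  match l with
  | [] => []
  | a :: l' => path_edges a (l' ++ [a])
  end.

Lemma length_path_edges {A} (a : A) l : length (path_edges a l) = length l.
Proof. revert a; induction l; simpl; auto. Qed.

Lemma length_cycle_edges {A} (l : list A) : length (cycle_edges l) = length l.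
Proof.
  destruct l; simpl; auto; rewrite length_path_edges, length_app; simpl.
  now rewrite Nat.add_comm.
Qed.

Definition xorsum {A} (f : A -> bool) (l : list A) : bool :=
  fold_right (fun x b => xorb (f x) b) false l.

Lemma xorsum_xorb {A} (f g : A -> bool) l :
  xorsum (fun x => xorb (f x) (g x)) l = xorb (xorsum f l) (xorsum g l).
Proof.
  induction l as [|x l IH]; simpl; auto; rewrite IH.
  destruct (f x), (g x), (xorsum f l), (xorsum g l); auto.
Qed.

Lemma xorsum_ext {A} (f g : A -> bool) l :
  (forall x, f x = g x) -> xorsum f l = xorsum g l.
Proof. intros H; induction l as [|x l IH]; simpl; auto; now rewrite H, IH. Qed.

Lemma xorsum_false {A} (f : A -> bool) l :
  (forall x, In x l -> f x = false) -> xorsum f l = false.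
Proof.
  induction l as [|x l IH]; simpl; intros H; auto.
  rewrite (H x), IH; auto.
Qed.

Lemma xorsum_true {A} (f : A -> bool) l :
  (forall x, In x l -> f x = true) -> xorsum f l = Nat.odd (length l).
Proof.
  induction l as [|x l IH]; intros H; auto.
  change (xorb (f x) (xorsum f l) = Nat.odd (S (length l))).
  rewrite (H x), IH, Nat.odd_succ, <- Nat.negb_odd; simpl; auto.
  intros; apply H; simpl; auto.
Qed.

Lemma xorsum_comm {A B} (f : A -> B -> bool) l m :
  xorsum (fun x => xorsum (f x) m) l = xorsum (fun y => xorsum (fun x => f x y) l) m.
Proof.
  induction l as [|x l IH]; simpl.
  - now rewrite xorsum_false.
  - now rewrite xorsum_xorb, IH.
Qed.

Lemma xorsum_path_edges {A} (g : A -> bool) (a : A) l :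
  xorsum (fun e => xorb (g (fst e)) (g (snd e))) (path_edges a l) =
  xorb (g a) (g (last l a)).
Proof.
  revert a; induction l as [|b l IH]; intros a.
  - simpl; now destruct (g a).
  - change (xorb (xorb (g a) (g b))
      (xorsum (fun e => xorb (g (fst e)) (g (snd e))) (path_edges b l)) =
      xorb (g a) (g (last (b :: l) a))).
    rewrite IH; replace (last (b :: l) a) with (last l b).
    + destruct (g a), (g b), (g (last l b)); auto.
    + clear; revert a b; induction l as [|c l IH]; intros a b; auto.
      change (last (c :: l) b = last (c :: l) a).
      now rewrite <- !IH.
Qed.

Lemma xorsum_cycle_edges {A} (g : A -> bool) (l : list A) :
  xorsum (fun e => xorb (g (fst e)) (g (snd e))) (cycle_edges l) = false.
Proof.
  destruct l as [|a l]; auto; unfold cycle_edges.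
  rewrite xorsum_path_edges, last_last; now destruct (g a).
Qed.

(** Summed modulo 2 over all pairs, the [g] terms telescope along [D] for fixed [e], and after
    exchanging the sums the [h] terms telescope along [C] for fixed [f]. The total is 0, whereas an
    odd number of pairs each contributing 1 would give 1. *)
Lemma odd_cycles_coboundary {A} (C D : list A)
    (g h : A * A -> A -> bool) :
  Nat.odd (length C) = true -> Nat.odd (length D) = true ->
  (forall e f, In e (cycle_edges C) -> In f (cycle_edges D) ->
     xorb (xorb (g e (fst f)) (g e (snd f))) (xorb (h f (fst e)) (h f (snd e))) = true) ->
  False.
Proof.
  intros HC HD H.
  assert (T : xorsum (fun e => xorsum (fun f =>
     xorb (xorb (g e (fst f)) (g e (snd f))) (xorb (h f (fst e)) (h f (snd e))))
     (cycle_edges D)) (cycle_edges C) = true).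
  { rewrite xorsum_true, length_cycle_edges; auto.
    intros e He; rewrite xorsum_true, length_cycle_edges; auto. }
  assert (F : xorsum (fun e => xorb
      (xorsum (fun f => xorb (g e (fst f)) (g e (snd f))) (cycle_edges D))
      (xorsum (fun f => xorb (h f (fst e)) (h f (snd e))) (cycle_edges D)))
      (cycle_edges C) = true).
  { rewrite <- T; apply xorsum_ext; intros e; symmetry; exact (xorsum_xorb _ _ _). }
  rewrite xorsum_xorb in F.
  rewrite (xorsum_comm (fun e f => xorb (h f (fst e)) (h f (snd e)))) in F.
  rewrite !xorsum_false in F; [discriminate | |];
    intros; apply xorsum_cycle_edges.
Qed.

(** * Perturbation into general position *)

Definition near0 (P : R -> Prop) : Prop :=
  exists d, 0 < d /\ forall t, 0 < t < d -> P t.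

Lemma near0_and P Q : near0 P -> near0 Q -> near0 (fun t => P t /\ Q t).
Proof.
  intros (d & Hd & HP) (d' & Hd' & HQ); exists (Rmin d d'); split.
  - now apply Rmin_pos.
  - intros t Ht; pose proof (Rmin_l d d'); pose proof (Rmin_r d d').
    split; [apply HP | apply HQ]; lra.
Qed.

Lemma near0_imp (P Q : R -> Prop) : (forall t, P t -> Q t) -> near0 P -> near0 Q.
Proof. intros H (d & Hd & HP); exists d; auto. Qed.

Lemma near0_ex P : near0 P -> exists t, P t.
Proof. intros (d & Hd & HP); exists (d / 2); apply HP; lra. Qed.

Lemma near0_forall_in {A} (P : A -> R -> Prop) l :
  (forall x, In x l -> near0 (P x)) -> near0 (fun t => forall x, In x l -> P x t).
Proof.
  induction l as [|x l IH]; intros H.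
  - exists 1; split; [lra | simpl; tauto].
  - apply near0_imp with (fun t => P x t /\ forall y, In y l -> P y t).
    + intros t [H1 H2] y [<-|Hy]; auto.
    + apply near0_and; [apply H; simpl; auto | apply IH; intros; apply H; simpl; auto].
Qed.

Lemma near0_lt d : 0 < d -> near0 (fun t => 0 < t < d).
Proof. intros; exists d; auto. Qed.

Lemma near0_neq0 A K (h : R -> R) :
  A <> 0 -> (forall t, 0 < t < 1 -> Rabs (h t) <= K) -> near0 (fun t => A + t * h t <> 0).
Proof.
  intros HA HK.
  assert (0 < Rabs A) by now apply Rabs_pos_lt.
  assert (0 <= K) by (apply Rle_trans with (1 := Rabs_pos (h (1/2))); apply HK; lra).
  assert (0 < Rabs A / (K + 1)) by (apply Rdiv_lt_0_compat; lra).
  exists (Rmin 1 (Rabs A / (K + 1))); split; [apply Rmin_pos; lra|].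
  intros t Ht E.
  pose proof (Rmin_l 1 (Rabs A / (K + 1))); pose proof (Rmin_r 1 (Rabs A / (K + 1))).
  assert (Hh : Rabs (h t) <= K) by (apply HK; lra).
  assert (EA : Rabs A = t * Rabs (h t)).
  { replace A with (- (t * h t)) by lra.
    rewrite Rabs_Ropp, Rabs_mult, (Rabs_pos_eq t) by lra; auto. }
  assert (t * (K + 1) < Rabs A).
  { replace (Rabs A) with (Rabs A / (K + 1) * (K + 1)) by (field; lra).
    apply Rmult_lt_compat_r; lra. }
  nra.
Qed.

(** After division by the lowest power of [t] that occurs, the constant term dominates for small
    [t]. *)
Lemma near0_cubic_neq0 A B C D :
  (A <> 0 \/ B <> 0 \/ C <> 0 \/ D <> 0) ->
  near0 (fun t => A + B * t + C * t ^ 2 + D * t ^ 3 <> 0).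
Proof.
  intros H.
  assert (bd : forall a b c t, 0 < t < 1 ->
      Rabs (a + t * (b + t * c)) <= Rabs a + (Rabs b + Rabs c)).
  { intros a b c t Ht.
    assert (K : forall u v, Rabs (u + t * v) <= Rabs u + Rabs v).
    { intros u v; apply Rle_trans with (1 := Rabs_triang _ _).
      rewrite Rabs_mult, (Rabs_pos_eq t) by lra; pose proof (Rabs_pos v); nra. }
    apply Rle_trans with (1 := K _ _); apply Rplus_le_compat_l; apply K. }
  destruct (Req_dec A 0) as [HA|HA]; [destruct (Req_dec B 0) as [HB|HB];
    [destruct (Req_dec C 0) as [HC|HC]|]|].
  - assert (D <> 0) by tauto.
    exists 1; split; [lra|]; intros t Ht E; subst.
    assert (0 < t ^ 3) by (apply pow_lt; lra).
    apply H0; apply Rmult_eq_reg_r with (t ^ 3); lra.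
  (* The zero terms pad the cofactor of [t] to the shape bounded by [bd]. *)
  - apply near0_imp with (fun t => 0 < t < 1 /\ C + t * (D + t * (0 + t * 0)) <> 0).
    + intros t [Ht Hn] E; apply Hn; subst.
      apply Rmult_eq_reg_r with (t ^ 2); [|apply pow_nonzero; lra].
      rewrite Rmult_0_l; etransitivity; [|exact E]; ring.
    + apply near0_and; [apply near0_lt; lra|].
      eapply near0_neq0; auto.
  - apply near0_imp with (fun t => 0 < t < 1 /\ B + t * (C + t * (D + t * 0)) <> 0).
    + intros t [Ht Hn] E; apply Hn; subst.
      apply Rmult_eq_reg_r with t; [|lra].
      rewrite Rmult_0_l; etransitivity; [|exact E]; ring.
    + apply near0_and; [apply near0_lt; lra|].
      eapply near0_neq0; auto.
  - apply near0_imp with (fun t => A + t * (B + t * (C + t * D)) <> 0).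
    + intros t Hn E; apply Hn; etransitivity; [|exact E]; ring.
    + eapply near0_neq0; auto.
Qed.

(** For small [t] > 0 this separates the abscissas of distinct points, and it preserves every
    orientation. *)
Definition shear (t : R) (p : pt) : pt := (fst p + t * snd p, snd p).
(** A translation, hence an isometry, applied to the second cycle only. Moving along a parabola
    leaves every line for small [t] > 0, even if the two cycles share points. *)
Definition nudge (t : R) (p : pt) : pt := (fst p + t, snd p + t ^ 2).
Definition on_edge (phi : pt -> pt) (e : pt * pt) : pt * pt := (phi (fst e), phi (snd e)).

Lemma orient_shear t a b c : orient (shear t a) (shear t b) (shear t c) = orient a b c.
Proof. unfold orient, shear; simpl; ring. Qed.

Lemma pt_neq (a b : pt) : a <> b -> fst b - fst a <> 0 \/ snd b - snd a <> 0.
Proof.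
  destruct a as [x y], b as [x' y']; simpl; intros H.
  destruct (Req_dec x x'); [right | left; lra].
  intros E; apply H; f_equal; lra.
Qed.

Lemma near0_generic_pair e f :
  fst e <> snd e -> fst f <> snd f ->
  near0 (fun t => generic_pair (on_edge (shear t) e)
                    (on_edge (fun q => shear t (nudge t q)) f)).
Proof.
  destruct e as [p p'], f as [q q']; simpl; intros He Hf.
  apply pt_neq in He, Hf.
  assert (Pe : forall a b : pt, fst b - fst a <> 0 \/ snd b - snd a <> 0 ->
     near0 (fun t => fst (shear t a) <> fst (shear t b))).
  { intros a b H.
    eapply near0_imp; [|apply (near0_cubic_neq0 (fst b - fst a) (snd b - snd a) 0 0); tauto].
    unfold shear; simpl; intros; lra. }
  assert (Pq : forall a b : pt, fst b - fst a <> 0 \/ snd b - snd a <> 0 ->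
     near0 (fun t => fst (shear t (nudge t a)) <> fst (shear t (nudge t b)))).
  { intros a b H.
    eapply near0_imp; [|apply (near0_cubic_neq0 (fst b - fst a) (snd b - snd a) 0 0); tauto].
    unfold shear, nudge; simpl; intros; lra. }
  (* The coefficient of [t ^ 3] is 1, so this holds even for [a = b]. *)
  assert (Px : forall a b : pt,
     near0 (fun t => fst (shear t a) <> fst (shear t (nudge t b)))).
  { intros a b.
    eapply near0_imp; [|apply (near0_cubic_neq0 (fst b - fst a) (1 + snd b - snd a) 0 1);
      right; right; right; lra].
    unfold shear, nudge; simpl; intros t H E; apply H; nra. }
  assert (P1 : forall a b c : pt, fst b - fst a <> 0 \/ snd b - snd a <> 0 ->
     near0 (fun t => orient (shear t a) (shear t b) (shear t (nudge t c)) <> 0)).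
  { intros a b c H.
    eapply near0_imp; [|apply (near0_cubic_neq0 (orient a b c)
      (- (snd b - snd a)) (fst b - fst a) 0); destruct H; [tauto | right; left; lra]].
    simpl; intros t Hn; rewrite orient_shear; unfold orient, nudge in *; simpl in *.
    intros E; apply Hn; etransitivity; [|exact E]; ring. }
  assert (P2 : forall a b c : pt, fst b - fst a <> 0 \/ snd b - snd a <> 0 ->
     near0 (fun t => orient (shear t (nudge t a)) (shear t (nudge t b)) (shear t c) <> 0)).
  { intros a b c H.
    eapply near0_imp; [|apply (near0_cubic_neq0 (orient a b c)
      (snd b - snd a) (- (fst b - fst a)) 0); destruct H; [right; right; left; lra | tauto]].
    simpl; intros t Hn; rewrite orient_shear; unfold orient, nudge in *; simpl in *.
    intros E; apply Hn; etransitivity; [|exact E]; ring. }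
  unfold generic_pair, on_edge; cbn [fst snd]; repeat apply near0_and; auto.
Qed.

Lemma edist_nudge t a b : 0 < t < 1 -> edist a (nudge t b) <= edist a b + 2 * t.
Proof.
  intros Ht; apply Rle_trans with (1 := edist_triangle a b _).
  apply Rplus_le_compat_l.
  apply Rsqr_incr_0_var; [|lra].
  rewrite !Rsqr_pow2, edist_sqr; unfold nudge; cbn [fst snd].
  assert (0 < t * t < 1) by nra.
  replace ((fst b - (fst b + t)) ^ 2 + (snd b - (snd b + t ^ 2)) ^ 2)
    with (t * t + (t * t) * (t * t)) by ring.
  replace ((2 * t) ^ 2) with (4 * (t * t)) by ring; nra.
Qed.

Definition exchange_decreases (e f : pt * pt) : Prop :=
  edist (fst e) (fst f) + edist (snd e) (snd f) <
    edist (fst e) (snd e) + edist (fst f) (snd f) /\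
  edist (fst e) (snd f) + edist (snd e) (fst f) <
    edist (fst e) (snd e) + edist (fst f) (snd f).

(** Strict loss in both exchanges leaves the slacks [g1] and [g2]. Nudging lengthens the two new
    edges by at most [4 * t] in all, so for small [t] both exchanges still lose, and the nudged
    edges cannot be opposite sides. *)
Lemma near0_pair_parity e f :
  exchange_decreases e f ->
  near0 (fun t => pair_parity (on_edge (shear t) e)
                    (on_edge (fun q => shear t (nudge t q)) f) = true).
Proof.
  destruct e as [p p'], f as [q q']; intros [H1 H2]; simpl in *.
  (* By the triangle inequality, an exchange with a loop never loses length. *)
  assert (Hp : p <> p').
  { intros <-; rewrite edist_refl in *.
    pose proof (edist_triangle q p q'); rewrite (edist_sym q p) in *; lra. }
  assert (Hq : q <> q').
  { intros <-; rewrite edist_refl in *.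
    pose proof (edist_triangle p q p'); rewrite (edist_sym p' q) in *; lra. }
  set (g1 := edist p p' + edist q q' - (edist p q + edist p' q')).
  set (g2 := edist p p' + edist q q' - (edist p q' + edist p' q)).
  eapply near0_imp; [|apply near0_and;
    [apply (near0_generic_pair (p, p') (q, q') Hp Hq) | apply near0_and;
    [apply (near0_lt 1); lra | apply near0_and;
    [apply (near0_lt (g1 / 4)) | apply (near0_lt (g2 / 4))]]]];
    [|unfold g1; lra | unfold g2; lra].
  intros t (G & Ht & Ht1 & Ht2); apply not_false_is_true; intros E.
  apply pair_parity_opposite_sides in E; auto.
  unfold opposite_sides, on_edge in E; simpl in E; rewrite !orient_shear in E.
  assert (N : edist (nudge t q) (nudge t q') = edist q q')
    by (unfold edist, nudge; simpl; f_equal; ring).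
  pose proof (edist_nudge t p q Ht); pose proof (edist_nudge t p' q Ht).
  pose proof (edist_nudge t p q' Ht); pose proof (edist_nudge t p' q' Ht).
  destruct (opposite_sides_edist p p' (nudge t q) (nudge t q') E) as [K|K];
    rewrite N in K; unfold g1, g2 in *; lra.
Qed.

(** Otherwise a single small [t] would give every pair of edges odd parity, against
    [odd_cycles_coboundary]. *)
Lemma odd_cycles_exchange (C D : list pt) :
  Nat.odd (length C) = true -> Nat.odd (length D) = true ->
  exists e f, In e (cycle_edges C) /\ In f (cycle_edges D) /\
    (edist (fst e) (snd e) + edist (fst f) (snd f) <=
       edist (fst e) (fst f) + edist (snd e) (snd f) \/
     edist (fst e) (snd e) + edist (fst f) (snd f) <=
       edist (fst e) (snd f) + edist (snd e) (fst f)).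
Proof.
  intros HC HD; apply NNPP; intros N.
  assert (X : forall e, In e (cycle_edges C) -> forall f, In f (cycle_edges D) ->
      exchange_decreases e f).
  { intros e He f Hf; unfold exchange_decreases.
    split; apply Rnot_le_lt; intros K; apply N; exists e, f; auto. }
  assert (Y : near0 (fun t => forall e, In e (cycle_edges C) ->
     forall f, In f (cycle_edges D) ->
      pair_parity (on_edge (shear t) e) (on_edge (fun q => shear t (nudge t q)) f) = true)).
  { apply near0_forall_in; intros e He; apply near0_forall_in; intros f Hf.
    apply near0_pair_parity; auto. }
  destruct (near0_ex _ Y) as [t Ht].
  apply (odd_cycles_coboundary C D
    (fun e q => side1 (on_edge (shear t) e) (shear t (nudge t q)))
    (fun f p => side2 (on_edge (fun q => shear t (nudge t q)) f) (shear t p))); auto.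
  intros e f He Hf; exact (Ht e He f Hf).
Qed.

(** * From cycle covers to matchings *)

Lemma cost_cons e M : cost (e :: M) = edist (fst e) (snd e) + cost M.
Proof. reflexivity. Qed.

Lemma cost_app M N : cost (M ++ N) = cost M + cost N.
Proof.
  induction M as [|e M IH]; simpl; [unfold cost at 2; simpl; ring|].
  rewrite !cost_cons, IH; ring.
Qed.

Lemma cost_perm M N : Permutation M N -> cost M = cost N.
Proof.
  induction 1; rewrite ?cost_cons; try lra.
Qed.

Lemma last_cons {A} (a b : A) l : last (b :: l) a = last l b.
Proof.
  revert a b; induction l as [|c l IH]; intros a b; auto.
  change (last (c :: l) a = last (c :: l) b); now rewrite !IH.
Qed.

Lemma path_edges_app {A} (a : A) l m :
  path_edges a (l ++ m) = path_edges a l ++ path_edges (last l a) m.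
Proof.
  revert a; induction l as [|b l IH]; intros a; [reflexivity|].
  rewrite last_cons; simpl; now rewrite IH.
Qed.

Lemma in_path_edges {A} (p q a : A) l :
  In (p, q) (path_edges a l) -> exists l1 l2, a :: l = l1 ++ p :: q :: l2.
Proof.
  revert a; induction l as [|b l IH]; intros a; simpl; [tauto|].
  intros [E|H].
  - injection E as -> ->; now exists [], l.
  - destruct (IH b H) as (l1 & l2 & E); exists (a :: l1), l2; simpl; now rewrite E.
Qed.

(** The list is rotated so that the cycle, cut at the given edge, becomes a path from [q] to [p]. *)
Lemma cycle_open_at (p q : pt) C :
  In (p, q) (cycle_edges C) ->
  exists l, Permutation (q :: l) C /\ last l q = p /\
    cost (cycle_edges C) = cost (path_edges q l) + edist p q.
Proof.
  destruct C as [|a m]; simpl; [tauto|]; intros H.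
  destruct (in_path_edges _ _ _ _ H) as ([|a' l1] & l2 & E).
  - injection E as -> E; exists l2; rewrite E; repeat split.
    + rewrite <- E; symmetry; apply Permutation_cons_append.
    + rewrite <- (last_cons p), <- E; apply last_last.
    + simpl; rewrite cost_cons; simpl; ring.
  - simpl in E; injection E as <- E.
    destruct (exists_last (l := q :: l2)) as (n & z & En); [discriminate|].
    assert (Hz : z = a /\ m = l1 ++ p :: n).
    { rewrite En in E.
      replace (l1 ++ p :: n ++ [z]) with ((l1 ++ p :: n) ++ [z]) in E
        by (rewrite <- app_assoc; reflexivity).
      apply app_inj_tail in E; now destruct E. }
    destruct Hz as [-> ->].
    exists (l2 ++ l1 ++ [p]); repeat split.
    + change (Permutation ((q :: l2) ++ l1 ++ [p]) (a :: l1 ++ p :: n)).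
      rewrite En, <- app_assoc.
      etransitivity; [apply Permutation_app_comm|]; simpl.
      constructor; rewrite <- app_assoc; reflexivity.
    + rewrite app_assoc; apply last_last.
    + rewrite E, path_edges_app, path_edges_app, !cost_app.
      replace (last l2 q) with a
        by (rewrite <- (last_cons q), En, last_last; reflexivity).
      rewrite path_edges_app, cost_app; simpl; rewrite !cost_cons; simpl.
      unfold cost at 5; simpl; ring.
Qed.

Lemma path_reverse (a : pt) l :
  exists l', Permutation (last l a :: l') (a :: l) /\ last l' (last l a) = a /\
    cost (path_edges (last l a) l') = cost (path_edges a l).
Proof.
  revert a; induction l as [|b l IH]; intros a.
  - now exists [].
  - rewrite last_cons; destruct (IH b) as (l' & HP & HL & HC).
    exists (l' ++ [a]); repeat split.
    + rewrite app_comm_cons, HP; symmetry; apply Permutation_cons_append.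
    + apply last_last.
    + rewrite path_edges_app, HL, cost_app, HC; simpl; rewrite !cost_cons; simpl.
      rewrite (edist_sym b a); unfold cost at 2; simpl; ring.
Qed.

Lemma cost_cycle_concat (a b : pt) l m :
  cost (cycle_edges ((a :: l) ++ b :: m)) =
  cost (path_edges a l) + edist (last l a) b + cost (path_edges b m) + edist (last m b) a.
Proof.
  simpl; rewrite <- app_assoc, path_edges_app, cost_app; simpl.
  rewrite cost_cons, path_edges_app, cost_app; simpl; rewrite cost_cons; simpl.
  unfold cost at 3; simpl; ring.
Qed.

(** Cutting both cycles leaves paths from [p'] to [p] and from [q'] to [q]. New edges [p q'] and
    [q p'] join them as they stand; for [p q] and [p' q'] the second path is reversed first. *)
Lemma merge_odd_cycles (C D : list pt) :
  Nat.odd (length C) = true -> Nat.odd (length D) = true ->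
  exists E, Permutation E (C ++ D) /\
    cost (cycle_edges C) + cost (cycle_edges D) <= cost (cycle_edges E).
Proof.
  intros HC HD.
  destruct (odd_cycles_exchange C D HC HD) as ([p p'] & [q q'] & He & Hf & H).
  destruct (cycle_open_at _ _ _ He) as (l & PC & LC & ->).
  destruct (cycle_open_at _ _ _ Hf) as (m & PD & LD & ->).
  simpl in H; destruct H as [H|H].
  - destruct (path_reverse q' m) as (m' & PD' & LD' & CD'); rewrite LD in *.
    exists ((p' :: l) ++ q :: m'); split.
    + now rewrite PC, PD', PD.
    + rewrite cost_cycle_concat, LC, LD', CD', (edist_sym q' p'); lra.
  - exists ((p' :: l) ++ q' :: m); split.
    + now rewrite PC, PD.
    + rewrite cost_cycle_concat, LC, LD, (edist_sym q p'); lra.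
Qed.

(** * Splitting even cycles into matchings *)

Fixpoint pair_up {A} (l : list A) : list (A * A) :=
  match l with
  | a :: b :: l' => (a, b) :: pair_up l'
  | _ => []
  end.

Lemma endpoints_pair_up n l : length l = (2 * n)%nat -> endpoints (pair_up l) = l.
Proof.
  revert l; induction n as [|n IH]; intros [|a [|b l]] H; simpl in *; try lia; auto.
  now rewrite IH by lia.
Qed.

(** The edges of the path belong alternately to the pairing that starts at [a] and to the one
    shifted by a vertex. *)
Lemma cost_path_alternate n l a : length l = (2 * n)%nat ->
  cost (path_edges a l) = cost (pair_up l) + cost (pair_up (removelast (a :: l))).
Proof.
  revert l a; induction n as [|n IH]; intros [|b [|c l]] a H; simpl in H; try lia.
  - unfold cost; simpl; ring.
  - change (removelast (a :: b :: c :: l)) with (a :: b :: removelast (c :: l)).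
    simpl pair_up; simpl path_edges; rewrite !cost_cons, (IH l c) by lia; simpl; ring.
Qed.

Lemma even_cycle_matching (C : list pt) :
  Nat.even (length C) = true ->
  exists M, Permutation (endpoints M) C /\ cost (cycle_edges C) <= 2 * cost M.
Proof.
  intros H; apply Nat.even_spec in H; destruct H as [n Hn].
  destruct C as [|a m].
  - exists []; split; [reflexivity | unfold cost; simpl; lra].
  - assert (L : length (m ++ [a]) = (2 * n)%nat)
      by (rewrite length_app; simpl in *; lia).
    (* Both pairings, of [a :: m] and of its rotation, match all vertices, and the costlier one
       carries at least half of the cycle. *)
    pose proof (cost_path_alternate n (m ++ [a]) a L) as E.
    rewrite app_comm_cons, removelast_last in E; simpl cycle_edges.
    destruct (Rle_lt_dec (cost (pair_up (m ++ [a]))) (cost (pair_up (a :: m)))).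
    + exists (pair_up (a :: m)); split; [|lra].
      now rewrite (endpoints_pair_up n) by auto.
    + exists (pair_up (m ++ [a])); split; [|lra].
      rewrite (endpoints_pair_up n) by auto; symmetry; apply Permutation_cons_append.
Qed.

Lemma odd_concat {A} (L : list (list A)) :
  Nat.odd (length (concat L)) = true ->
  exists L1 D L2, L = L1 ++ D :: L2 /\ Nat.odd (length D) = true.
Proof.
  induction L as [|C L IH]; simpl; [discriminate|].
  rewrite length_app, Nat.odd_add.
  destruct (Nat.odd (length C)) eqn:HC.
  - intros _; now exists [], C, L.
  - intros H; destruct IH as (L1 & D & L2 & -> & HD); [now destruct (Nat.odd _)|].
    now exists (C :: L1), D, L2.
Qed.

Lemma endpoints_app M N : endpoints (M ++ N) = endpoints M ++ endpoints N.
Proof. apply flat_map_app. Qed.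

(** Induction on the number of cycles. An even cycle is matched by itself; an odd one has an odd
    partner because the total is even, and merging the two leaves one cycle fewer. *)
Lemma cycles_matching (L : list (list pt)) :
  Nat.even (length (concat L)) = true ->
  exists M, Permutation (endpoints M) (concat L) /\
    cost (flat_map cycle_edges L) <= 2 * cost M.
Proof.
  remember (length L) as n eqn:Hn; revert L Hn.
  induction n as [n IH] using (well_founded_induction Wf_nat.lt_wf); intros [|C L] Hn.
  - exists []; split; [reflexivity | unfold cost; simpl; lra].
  - simpl concat; simpl flat_map; simpl in Hn.
    rewrite length_app, Nat.even_add, cost_app; intros H.
    destruct (Nat.even (length C)) eqn:HC.
    + destruct (IH (length L)) with (L := L) as (M & PM & CM); [lia | auto | |].
      { now destruct (Nat.even (length (concat L))). }
      destruct (even_cycle_matching C HC) as (N & PN & CN).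
      exists (N ++ M); rewrite endpoints_app, cost_app; split; [|lra].
      now apply Permutation_app.
    + destruct (odd_concat L) as (L1 & D & L2 & -> & HD).
      { rewrite <- Nat.negb_even; now destruct (Nat.even (length (concat L))). }
      destruct (merge_odd_cycles C D) as (E & PE & CE); auto.
      { rewrite <- Nat.negb_even, HC; auto. }
      assert (PP : Permutation (concat (E :: L1 ++ L2)) (C ++ concat (L1 ++ D :: L2))).
      { simpl; rewrite !concat_app; simpl; rewrite PE, <- app_assoc.
        apply Permutation_app_head; rewrite !app_assoc.
        apply Permutation_app_tail, Permutation_app_comm. }
      destruct (IH (length (E :: L1 ++ L2))) with (L := E :: L1 ++ L2) as (M & PM & CM).
      * rewrite Hn; simpl; rewrite !length_app; simpl; lia.
      * reflexivity.
      * rewrite (Permutation_length PP), length_app, Nat.even_add, HC.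
        now destruct (Nat.even (length (concat (L1 ++ D :: L2)))).
      * exists M; split; [now rewrite PM|].
        simpl in CM; rewrite flat_map_app, !cost_app in *; simpl; rewrite cost_app; lra.
Qed.

Lemma balanced_walk {A} (eq_dec : forall x y : A, {x = y} + {x <> y}) n :
  forall (E : list (A * A)) (a b x : A), length E = n ->
  Permutation (a :: map fst E) (b :: map snd E) ->
  exists m E', Permutation ((x, b) :: E) (path_edges x (m ++ [a]) ++ E') /\
    Permutation (map fst E') (map snd E') /\ (length E' <= n)%nat.
Proof.
  induction n as [|n IH]; intros E a b x Hn HP.
  - destruct E; [|discriminate]; simpl in HP.
    apply Permutation_length_1 in HP; subst b.
    exists [], []; repeat split; auto.
  - destruct (eq_dec a b) as [<-|Hab].
    + exists [], E; apply Permutation_cons_inv in HP; repeat split; auto; lia.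
    + assert (Hb : In b (map fst E)).
      { assert (In b (a :: map fst E)) as [?|?]; [|congruence|auto].
        rewrite HP; simpl; auto. }
      apply in_map_iff in Hb; destruct Hb as ((b' & c) & Eb & Hc); simpl in Eb; subst b'.
      destruct (in_split _ _ Hc) as (E1 & E2 & ->).
      assert (PE : Permutation (E1 ++ (b, c) :: E2) ((b, c) :: E1 ++ E2))
        by (symmetry; apply Permutation_middle).
      destruct (IH (E1 ++ E2) a c b) as (m & E' & P1 & P2 & P3).
      * rewrite length_app in *; simpl in *; lia.
      * rewrite PE in HP; simpl in HP.
        apply (Permutation_cons_inv (a := b)); rewrite <- HP; constructor.
      * exists (b :: m), E'; repeat split; auto; simpl.
        now rewrite PE, P1.
Qed.

Lemma balanced_cycles {A} (eq_dec : forall x y : A, {x = y} + {x <> y})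
    (E : list (A * A)) :
  Permutation (map fst E) (map snd E) ->
  exists L, Permutation E (flat_map cycle_edges L).
Proof.
  remember (length E) as n eqn:Hn; revert E Hn.
  induction n as [n IH] using (well_founded_induction Wf_nat.lt_wf); intros [|[a b] E] Hn HP.
  - now exists [].
  - simpl in *.
    destruct (balanced_walk eq_dec (length E) E a b a eq_refl HP) as (m & E' & P1 & P2 & P3).
    destruct (IH (length E')) with (E := E') as (L & PL); auto; [lia|].
    exists ((a :: m) :: L); simpl; now rewrite P1, PL.
Qed.

Lemma map_fst_path_edges {A} (a : A) l b : map fst (path_edges a (l ++ [b])) = a :: l.
Proof. revert a; induction l as [|c l IH]; intros a; simpl; auto; now rewrite IH. Qed.

Lemma map_snd_path_edges {A} (a : A) l : map snd (path_edges a l) = l.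
Proof. revert a; induction l as [|c l IH]; intros a; simpl; auto; now rewrite IH. Qed.

Lemma map_fst_cycle_edges {A} (l : list A) : map fst (cycle_edges l) = l.
Proof. destruct l; [reflexivity | apply map_fst_path_edges]. Qed.

Lemma map_snd_cycle_edges {A} (l : list A) : Permutation (map snd (cycle_edges l)) l.
Proof.
  destruct l; [reflexivity|]; simpl; rewrite map_snd_path_edges.
  symmetry; apply Permutation_cons_append.
Qed.

Lemma pt_eq_dec (a b : pt) : {a = b} + {a <> b}.
Proof. decide equality; apply Req_EM_T. Qed.

(** Each point of [S] is left once and entered once, so [E] is a permutation of [S] drawn as arcs.
    It decomposes into cycles covering [S], to which the merging argument applies. *)
Lemma assignment_matching (S : list pt) (E : list (pt * pt)) :
  Nat.even (length S) = true ->
  Permutation (map fst E) S -> Permutation (map snd E) S ->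
  exists M, Permutation (endpoints M) S /\ cost E <= 2 * cost M.
Proof.
  intros HS H1 H2.
  destruct (balanced_cycles pt_eq_dec E) as (L & PL); [now rewrite H1, H2|].
  assert (PS : Permutation (concat L) S).
  { rewrite <- H1, PL, flat_map_concat_map, concat_map, map_map.
    rewrite (map_ext _ (fun l => l)) by apply map_fst_cycle_edges.
    now rewrite map_id. }
  destruct (cycles_matching L) as (M & PM & CM).
  - now rewrite (Permutation_length PS).
  - exists M; split; [now rewrite PM|].
    now rewrite (cost_perm _ _ PL).
Qed.

(** * Dual radii *)

Definition Rsum {A} (f : A -> R) (l : list A) : R := fold_right Rplus 0 (map f l).

Lemma Rsum_cons {A} (f : A -> R) x l : Rsum f (x :: l) = f x + Rsum f l.
Proof. reflexivity. Qed.

Lemma Rsum_app {A} (f : A -> R) l m : Rsum f (l ++ m) = Rsum f l + Rsum f m.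
Proof.
  induction l as [|x l IH]; simpl; [unfold Rsum at 2; simpl; ring|].
  rewrite !Rsum_cons, IH; ring.
Qed.

Lemma Rsum_map {A B} (f : B -> R) (h : A -> B) l : Rsum f (map h l) = Rsum (fun x => f (h x)) l.
Proof. unfold Rsum; now rewrite map_map. Qed.

Lemma Rsum_minus {A} (f g : A -> R) l : Rsum (fun x => f x - g x) l = Rsum f l - Rsum g l.
Proof. induction l as [|x l IH]; rewrite ?Rsum_cons; [unfold Rsum; simpl|]; lra. Qed.

Definition weight {V} (g : V -> V -> R) (E : list (V * V)) : R :=
  Rsum (fun e => g (fst e) (snd e)) E.

Lemma exists_max {A} (f : A -> R) (l : list A) :
  l <> [] -> exists x, In x l /\ forall y, In y l -> f y <= f x.
Proof.
  induction l as [|a l IH]; intros H; [congruence|].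
  destruct l as [|b l].
  - exists a; split; simpl; auto; intros y [<-|[]]; lra.
  - destruct IH as (x & Hx & Mx); [discriminate|].
    destruct (Rle_lt_dec (f x) (f a)).
    + exists a; split; [simpl; auto|]; intros y [<-|Hy]; [lra|].
      specialize (Mx y Hy); lra.
    + exists x; split; [simpl; auto|]; intros y [<-|Hy]; [lra|auto].
Qed.

(** Each step is expanded into whichever of the direct step and the detour through [v] attains the
    maximum, so closed walks for the reduced gains come from closed walks for [g]. *)
Lemma shortcut_path {V} (g : V -> V -> R) (v : V) (vs : list V) (l : list V) (a b : V) :
  (forall x, In x l -> In x vs) ->
  exists m, (forall x, In x m -> In x (v :: vs)) /\
    weight (fun x y => Rmax (g x y) (g x v + g v y)) (path_edges a (l ++ [b])) =
    weight g (path_edges a (m ++ [b])).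
Proof.
  assert (step : forall x y, exists s, (forall z, In z s -> z = v) /\
     forall t, weight g (path_edges x (s ++ y :: t)) =
       Rmax (g x y) (g x v + g v y) + weight g (path_edges y t)).
  { intros x y; destruct (Rle_lt_dec (g x v + g v y) (g x y)).
    - exists []; split; [simpl; tauto|]; intros t; simpl.
      unfold weight; rewrite Rsum_cons, Rmax_left; simpl; lra.
    - exists [v]; split; [simpl; intuition|]; intros t; simpl.
      unfold weight; rewrite !Rsum_cons, Rmax_right; simpl; lra. }
  revert a; induction l as [|c l IH]; intros a Hl.
  - destruct (step a b) as (s & Hs & E); exists s; split.
    + intros x Hx; rewrite (Hs x Hx); simpl; auto.
    + rewrite E; simpl; unfold weight; rewrite Rsum_cons; simpl; reflexivity.
  - destruct (step a c) as (s & Hs & E).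
    destruct (IH c) as (m & Hm & Em); [intros; apply Hl; simpl; auto|].
    exists (s ++ c :: m); split.
    + intros x Hx; apply in_app_iff in Hx; destruct Hx as [Hx|[<-|Hx]]; auto.
      * rewrite (Hs x Hx); simpl; auto.
      * right; apply Hl; simpl; auto.
    + rewrite <- app_assoc; simpl app; rewrite E, <- Em.
      simpl; unfold weight at 1; rewrite Rsum_cons; reflexivity.
Qed.

(* Fourier-Motzkin: eliminating v replaces each gain g x y by the better of the
   direct step and the detour through v. *)
Lemma potential_exists {V} (eq_dec : forall x y : V, {x = y} + {x <> y}) (vs : list V) :
  forall g : V -> V -> R,
  (forall a l, (forall x, In x (a :: l) -> In x vs) -> weight g (cycle_edges (a :: l)) <= 0) ->
  exists u : V -> R, forall x y, In x vs -> In y vs -> u x + g x y <= u y.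
Proof.
  induction vs as [|v vs IH]; intros g Hg.
  - exists (fun _ => 0); simpl; tauto.
  - destruct (IH (fun x y => Rmax (g x y) (g x v + g v y))) as (u & Hu).
    { intros a l Hl; simpl cycle_edges.
      destruct (shortcut_path g v vs l a a) as (m & Hm & ->).
      - intros; apply Hl; simpl; auto.
      - apply (Hg a m); intros x [<-|Hx]; auto; right; apply Hl; simpl; auto. }
    (* The loop at [v], needed for the case [x = y = v]. *)
    assert (Hv : g v v <= 0).
    { specialize (Hg v []); simpl in Hg; unfold weight in Hg; rewrite Rsum_cons in Hg.
      unfold Rsum in Hg; simpl in Hg; rewrite Rplus_0_r in Hg; apply Hg; tauto. }
    (* The value at [v] is the largest of its lower bounds. It respects the upper bounds because [u]
       accounts for detours through [v]; without other vertices any value works. *)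
    assert (X : exists w, (forall x, In x vs -> u x + g x v <= w) /\
                          (forall y, In y vs -> w + g v y <= u y)).
    { destruct vs as [|c vs'] eqn:Evs; [exists 0; simpl; tauto|].
      destruct (exists_max (fun x => u x + g x v) vs) as (x & Hx & Mx);
        [subst; discriminate|].
      rewrite <- Evs in *; exists (u x + g x v); split; auto.
      intros y Hy; specialize (Hu x y Hx Hy); simpl in Hu.
      pose proof (Rmax_r (g x y) (g x v + g v y)); lra. }
    destruct X as (w & Hw1 & Hw2).
    exists (fun x => if eq_dec x v then w else u x); intros x y Hx Hy.
    destruct (eq_dec x v) as [->|Nx], (eq_dec y v) as [->|Ny].
    + lra.
    + apply Hw2; destruct Hy; congruence.
    + apply Hw1; destruct Hx; congruence.
    + destruct Hx as [?|Hx]; [congruence|]; destruct Hy as [?|Hy]; [congruence|].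
      specialize (Hu x y Hx Hy); simpl in Hu.
      pose proof (Rmax_l (g x y) (g x v + g v y)); lra.
Qed.

Lemma weight_cycle_split {V} (g : V -> V -> R) (d : V) l1 l2 l3 :
  weight g (cycle_edges (l1 ++ d :: l2 ++ d :: l3)) =
  weight g (cycle_edges (d :: l2)) + weight g (cycle_edges (d :: l3 ++ l1)).
Proof.
  unfold weight; destruct l1 as [|a l1]; simpl.
  - rewrite app_nil_r, <- app_assoc; simpl.
    replace (l2 ++ d :: l3 ++ [d]) with ((l2 ++ [d]) ++ l3 ++ [d])
      by (rewrite <- app_assoc; reflexivity).
    rewrite path_edges_app, Rsum_app, last_last; reflexivity.
  - replace ((l1 ++ d :: l2 ++ d :: l3) ++ [a])
      with ((l1 ++ [d]) ++ (l2 ++ [d]) ++ (l3 ++ [a]))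
      by (rewrite <- !app_assoc; simpl; rewrite <- !app_assoc; reflexivity).
    replace ((l3 ++ a :: l1) ++ [d]) with ((l3 ++ [a]) ++ l1 ++ [d])
      by (rewrite <- !app_assoc; reflexivity).
    rewrite !(path_edges_app _ (l1 ++ [d])), !(path_edges_app _ (l2 ++ [d])),
      !(path_edges_app _ (l3 ++ [a])), !Rsum_app, !last_last; ring.
Qed.

(** A closed walk splits at a repeated vertex into two shorter closed walks. Potentials require all
    closed walks, whereas maximality of a matching directly controls only the simple ones. *)
Lemma simple_cycles_suffice {V} (eq_dec : forall x y : V, {x = y} + {x <> y})
    (g : V -> V -> R) (vs : list V) :
  (forall C, NoDup C -> incl C vs -> weight g (cycle_edges C) <= 0) ->
  forall C, incl C vs -> weight g (cycle_edges C) <= 0.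
Proof.
  intros H C; remember (length C) as n eqn:Hn; revert C Hn.
  induction n as [n IH] using (well_founded_induction Wf_nat.lt_wf); intros C Hn HC.
  destruct (ListDec.NoDup_dec eq_dec C) as [D|D]; [auto|].
  assert (X : exists d l1 l2 l3, C = l1 ++ d :: l2 ++ d :: l3).
  { apply not_NoDup in D; [exact D|].
    intros x y; destruct (eq_dec x y); [left | right]; auto. }
  destruct X as (d & l1 & l2 & l3 & ->).
  rewrite weight_cycle_split.
  assert (Hd : In d vs) by (apply HC, in_app_iff; simpl; auto).
  rewrite !length_app in Hn; simpl in Hn; rewrite length_app in Hn; simpl in Hn.
  assert (weight g (cycle_edges (d :: l2)) <= 0).
  { apply (IH (length (d :: l2))); auto; [simpl; lia|].
    intros x [<-|Hx]; auto; apply HC; rewrite !in_app_iff; simpl; rewrite !in_app_iff; auto. }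
  assert (weight g (cycle_edges (d :: l3 ++ l1)) <= 0).
  { apply (IH (length (d :: l3 ++ l1))); auto; [simpl; rewrite length_app; lia|].
    intros x [<-|Hx]; auto; apply HC; rewrite !in_app_iff in *; simpl.
    rewrite in_app_iff; simpl; tauto. }
  lra.
Qed.

Lemma NoDup_incl_complement {A} (l m : list A) :
  NoDup l -> incl l m -> exists r, Permutation m (l ++ r).
Proof.
  revert m; induction l as [|a l IH]; intros m D I.
  - now exists m.
  - inversion D as [|? ? Ha Dl]; subst.
    destruct (in_split a m) as (m1 & m2 & ->); [apply I; simpl; auto|].
    destruct (IH (m1 ++ m2)) as (r & Hr); auto.
    + intros x Hx; assert (Hm : In x (m1 ++ a :: m2)) by (apply I; simpl; auto).
      apply in_app_iff in Hm; apply in_app_iff; destruct Hm as [|[<-|]]; auto; tauto.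
    + exists r; simpl; rewrite <- Hr; symmetry; apply Permutation_middle.
Qed.

(** * Radii from the maximality of a matching *)

Definition swap (e : pt * pt) : pt * pt := (snd e, fst e).

(** A directed edge serves as a label for its first end, and [swap] then gives the partner of that
    end in the matching. *)
Definition directed_edges (M : list (pt * pt)) : list (pt * pt) := M ++ map swap M.

Lemma swap_involutive e : swap (swap e) = e.
Proof. now destruct e. Qed.

Lemma in_directed_edges_swap M d : In d (directed_edges M) -> In (swap d) (directed_edges M).
Proof.
  unfold directed_edges; rewrite !in_app_iff, !in_map_iff; intros [H|(e & <- & H)].
  - right; now exists d.
  - left; now rewrite swap_involutive.
Qed.

Lemma fst_directed_edges M : Permutation (map fst (directed_edges M)) (endpoints M).
Proof.
  unfold directed_edges; rewrite map_app, map_map; simpl.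
  induction M as [|[a b] M IH]; simpl; auto.
  constructor; rewrite <- Permutation_middle; now constructor.
Qed.

Lemma snd_directed_edges M : Permutation (map snd (directed_edges M)) (endpoints M).
Proof.
  rewrite <- fst_directed_edges; unfold directed_edges.
  rewrite !map_app, !map_map; simpl; apply Permutation_app_comm.
Qed.

Lemma cost_directed_edges M : cost (directed_edges M) = 2 * cost M.
Proof.
  unfold directed_edges; rewrite cost_app.
  enough (cost (map swap M) = cost M) by lra.
  induction M as [|[a b] M IH]; simpl; auto.
  rewrite !cost_cons, IH; simpl; now rewrite edist_sym.
Qed.

(** The change of length when the edge [d] is replaced by the arc from its second end to the first
    end of [d']. *)
Definition gain (d d' : pt * pt) : R := edist (snd d) (fst d') - edist (fst d) (snd d).

(** Performing these replacements along [C] turns the doubled matching into an assignment on [S],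
    whose length is at most twice the cost of some matching, hence of [M]. The weight of [C] is the
    change of length. *)
Lemma max_sum_simple_cycle (S : list pt) (M C : list (pt * pt)) :
  is_max_sum_matching S M -> NoDup C -> incl C (directed_edges M) ->
  weight gain (cycle_edges C) <= 0.
Proof.
  intros [PM MM] DC IC.
  destruct (NoDup_incl_complement C (directed_edges M) DC IC) as (r & Pr).
  (* The untouched edges [r] are reversed so that all arcs start at second ends and finish at first
     ends. *)
  set (E := map (fun c => (snd (fst c), fst (snd c))) (cycle_edges C) ++ map swap r).
  assert (HS : Nat.even (length S) = true).
  { rewrite <- (Permutation_length PM); clear.
    induction M as [|e M IH]; auto. }
  destruct (assignment_matching S E HS) as (M' & PM' & CM').
  - unfold E; rewrite map_app, !map_map; simpl.
    rewrite <- (map_map fst snd), map_fst_cycle_edges, <- map_app, <- Pr.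
    now rewrite snd_directed_edges.
  - unfold E; rewrite map_app, !map_map; simpl.
    rewrite <- (map_map snd fst), map_snd_cycle_edges, <- map_app, <- Pr.
    now rewrite fst_directed_edges.
  - specialize (MM M' PM').
    assert (CE : cost E = Rsum (fun c => edist (snd (fst c)) (fst (snd c))) (cycle_edges C)
                 + cost r).
    { unfold E; rewrite cost_app; f_equal.
      - apply (Rsum_map (fun e => edist (fst e) (snd e))).
      - clear; induction r as [|[a b] r IH]; simpl; auto.
        rewrite !cost_cons, IH; simpl; now rewrite edist_sym. }
    assert (CD : cost (directed_edges M) = cost C + cost r)
      by now rewrite (cost_perm _ _ Pr), cost_app.
    rewrite cost_directed_edges in CD.
    unfold weight, gain; rewrite Rsum_minus.
    assert (CC : Rsum (fun e => edist (fst (fst e)) (snd (fst e))) (cycle_edges C) = cost C).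
    { rewrite <- (map_fst_cycle_edges C) at 2; symmetry.
      apply (Rsum_map (fun e => edist (fst e) (snd e)) fst). }
    rewrite CC; lra.
Qed.

Lemma max_sum_radii (S : list pt) (M : list (pt * pt)) :
  is_max_sum_matching S M ->
  exists y : pt * pt -> R,
    (forall d, In d M -> y d + y (swap d) = edist (fst d) (snd d)) /\
    (forall d d', In d (directed_edges M) -> In d' (directed_edges M) ->
       edist (fst d) (fst d') <= y d + y d').
Proof.
  intros HM.
  assert (eq_dec : forall x y : pt * pt, {x = y} + {x <> y})
    by (decide equality; apply pt_eq_dec).
  destruct (potential_exists eq_dec (directed_edges M) gain) as (u & Hu).
  { intros a l Hl; apply (simple_cycles_suffice eq_dec gain (directed_edges M)).
    - intros C; now apply max_sum_simple_cycle with S.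
    - exact Hl. }
  (* Antisymmetrising the potential yields the equality on edges. The bound for [d], [d'] is half
     the sum of the potential inequalities from [swap d'] to [d] and from [swap d] to [d']. *)
  exists (fun d => (u d - u (swap d) + edist (fst d) (snd d)) / 2); split.
  - intros d _; rewrite swap_involutive; simpl.
    rewrite (edist_sym (snd d) (fst d)); lra.
  - intros d d' Hd Hd'.
    pose proof (Hu (swap d') d (in_directed_edges_swap _ _ Hd') Hd) as H1.
    pose proof (Hu (swap d) d' (in_directed_edges_swap _ _ Hd) Hd') as H2.
    unfold gain in H1, H2; simpl in H1, H2.
    rewrite (edist_sym (snd d) (fst d)) in H2; rewrite (edist_sym (snd d') (fst d')) in H1.
    rewrite (edist_sym (fst d') (fst d)) in H1; lra.
Qed.

(** * Disks meeting pairwise *)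

Definition convex (A : pt -> Prop) : Prop :=
  forall x y t, 0 <= t <= 1 -> A x -> A y ->
    A ((1 - t) * fst x + t * fst y, (1 - t) * snd x + t * snd y).

Lemma convex_inter A B : convex A -> convex B -> convex (fun x => A x /\ B x).
Proof. intros HA HB x y t Ht [] []; split; auto. Qed.

Lemma convex_comb2 A (x y z : pt) a b : convex A -> 0 <= a -> 0 <= b -> 0 < a + b ->
  A x -> A y ->
  (a + b) * fst z = a * fst x + b * fst y -> (a + b) * snd z = a * snd x + b * snd y -> A z.
Proof.
  intros HA Ha Hb Hs Hx Hy E1 E2.
  replace z with ((1 - b / (a + b)) * fst x + b / (a + b) * fst y,
                  (1 - b / (a + b)) * snd x + b / (a + b) * snd y).
  - apply HA; auto; split.
    + apply Rmult_le_pos; auto; apply Rlt_le, Rinv_0_lt_compat; auto.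
    + apply Rmult_le_reg_r with (a + b); auto.
      unfold Rdiv; rewrite Rmult_assoc, Rinv_l; lra.
  - rewrite (surjective_pairing z); f_equal; apply Rmult_eq_reg_l with (a + b); try lra;
      [rewrite E1 | rewrite E2]; field; lra.
Qed.

Lemma convex_comb3 A (x y w z : pt) a b c : convex A ->
  0 <= a -> 0 <= b -> 0 <= c -> 0 < a + b + c -> A x -> A y -> A w ->
  (a + b + c) * fst z = a * fst x + b * fst y + c * fst w ->
  (a + b + c) * snd z = a * snd x + b * snd y + c * snd w -> A z.
Proof.
  intros HA Ha Hb Hc Hs Hx Hy Hw E1 E2.
  destruct (Req_dec (a + b) 0) as [H0|H0].
  - assert (a = 0) by lra; assert (b = 0) by lra; subst.
    apply (convex_comb2 A w w z c 0); auto; lra.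
  - set (m := ((a * fst x + b * fst y) / (a + b), (a * snd x + b * snd y) / (a + b))).
    assert (Hm : A m).
    { apply (convex_comb2 A x y m a b); auto; try lra; unfold m; simpl; field; auto. }
    apply (convex_comb2 A m w z (a + b) c); auto; try lra; unfold m; simpl.
    + rewrite E1; field; auto.
    + rewrite E2; field; auto.
Qed.

(** By Cramer's rule the coefficients are signed areas of the triangles formed by the other three
    points; if the first three points are collinear, a dependence among them suffices. *)
Lemma affine_dependence (x1 x2 x3 x4 : pt) : exists a1 a2 a3 a4,
  (a1 <> 0 \/ a2 <> 0 \/ a3 <> 0 \/ a4 <> 0) /\ a1 + a2 + a3 + a4 = 0 /\
  a1 * fst x1 + a2 * fst x2 + a3 * fst x3 + a4 * fst x4 = 0 /\
  a1 * snd x1 + a2 * snd x2 + a3 * snd x3 + a4 * snd x4 = 0.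
Proof.
  destruct (Req_dec (orient x1 x2 x3) 0) as [H0|H0].
  - unfold orient in H0.
    destruct (Req_dec (fst x1) (fst x2)) as [H1|H1];
      [destruct (Req_dec (snd x1) (snd x2)) as [H2|H2]|].
    + exists 1, (-1), 0, 0; repeat split; lra.
    + exists (snd x3 - snd x2), (snd x1 - snd x3), (snd x2 - snd x1), 0.
      repeat split; lra.
    + exists (fst x3 - fst x2), (fst x1 - fst x3), (fst x2 - fst x1), 0.
      repeat split; lra.
  - exists (orient x2 x3 x4), (- orient x1 x3 x4), (orient x1 x2 x4), (- orient x1 x2 x3).
    unfold orient in *; repeat split; try ring; right; right; right; lra.
Qed.

(** Radon's argument: separating positive from negative coefficients in an affine dependence writes
    one point [z] as a convex combination in two ways, and each [xi] occurs in at most one of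
    them. *)
Lemma helly4 (A B C D : pt -> Prop) (x1 x2 x3 x4 : pt) :
  convex A -> convex B -> convex C -> convex D ->
  B x1 /\ C x1 /\ D x1 -> A x2 /\ C x2 /\ D x2 ->
  A x3 /\ B x3 /\ D x3 -> A x4 /\ B x4 /\ C x4 ->
  exists z, A z /\ B z /\ C z /\ D z.
Proof.
  intros HA HB HC HD (B1 & C1 & D1) (A2 & C2 & D2) (A3 & B3 & D3) (A4 & B4 & C4).
  destruct (affine_dependence x1 x2 x3 x4) as (a1 & a2 & a3 & a4 & Hn & Hs & Hx & Hy).
  set (pos := fun a => Rmax a 0).
  assert (P0 : forall a, 0 <= pos a) by (intros; apply Rmax_r).
  assert (PN : forall a, a = pos a - pos (- a)).
  { intros a; unfold pos, Rmax; destruct (Rle_dec a 0), (Rle_dec (-a) 0); lra. }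
  assert (PZ : forall a, pos a = 0 \/ pos (- a) = 0).
  { intros a; unfold pos, Rmax; destruct (Rle_dec a 0), (Rle_dec (-a) 0); lra. }
  pose proof (P0 a1); pose proof (P0 a2); pose proof (P0 a3); pose proof (P0 a4).
  pose proof (P0 (- a1)); pose proof (P0 (- a2)); pose proof (P0 (- a3)); pose proof (P0 (- a4)).
  pose proof (PZ a1) as Z1; pose proof (PZ a2) as Z2.
  pose proof (PZ a3) as Z3; pose proof (PZ a4) as Z4.
  rewrite (PN a1), (PN a2), (PN a3), (PN a4) in Hn, Hs, Hx, Hy.
  generalize dependent (pos (- a1)); generalize dependent (pos (- a2)).
  generalize dependent (pos (- a3)); generalize dependent (pos (- a4)).
  generalize dependent (pos a1); generalize dependent (pos a2).
  generalize dependent (pos a3); generalize dependent (pos a4);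
    clear - HA HB HC HD B1 C1 D1 A2 C2 D2 A3 B3 D3 A4 B4 C4.
  intros p4 P4 p3 P3 p2 P2 p1 P1 n4 N4 Z4 n3 N3 Z3 n2 N2 Z2 n1 Hn Hs Hx Hy N1 Z1.
  set (s := p1 + p2 + p3 + p4).
  assert (S0 : 0 < s).
  { apply Rnot_le_lt; unfold s; intros K.
    destruct Hn as [Hn|[Hn|[Hn|Hn]]]; apply Hn; lra. }
  assert (S1 : s = n1 + n2 + n3 + n4) by (unfold s; lra).
  set (z := ((p1 * fst x1 + p2 * fst x2 + p3 * fst x3 + p4 * fst x4) / s,
             (p1 * snd x1 + p2 * snd x2 + p3 * snd x3 + p4 * snd x4) / s) : pt).
  assert (X1 : s * fst z = p1 * fst x1 + p2 * fst x2 + p3 * fst x3 + p4 * fst x4)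
    by (unfold z; simpl; field; lra).
  assert (Y1 : s * snd z = p1 * snd x1 + p2 * snd x2 + p3 * snd x3 + p4 * snd x4)
    by (unfold z; simpl; field; lra).
  assert (X2 : s * fst z = n1 * fst x1 + n2 * fst x2 + n3 * fst x3 + n4 * fst x4) by lra.
  assert (Y2 : s * snd z = n1 * snd x1 + n2 * snd x2 + n3 * snd x3 + n4 * snd x4) by lra.
  assert (S2 : s = p1 + p2 + p3 + p4) by reflexivity.
  clearbody z s; exists z; repeat split.
  (* Only [x1] may lie outside [A], and it is absent from one of the two representations of [z]. *)
  - destruct Z1 as [-> | ->].
    + replace s with (p2 + p3 + p4) in * by lra.
      apply (convex_comb3 A x2 x3 x4 z p2 p3 p4); auto; lra.
    + replace s with (n2 + n3 + n4) in * by lra.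
      apply (convex_comb3 A x2 x3 x4 z n2 n3 n4); auto; lra.
  - destruct Z2 as [-> | ->].
    + replace s with (p1 + p3 + p4) in * by lra.
      apply (convex_comb3 B x1 x3 x4 z p1 p3 p4); auto; lra.
    + replace s with (n1 + n3 + n4) in * by lra.
      apply (convex_comb3 B x1 x3 x4 z n1 n3 n4); auto; lra.
  - destruct Z3 as [-> | ->].
    + replace s with (p1 + p2 + p4) in * by lra.
      apply (convex_comb3 C x1 x2 x4 z p1 p2 p4); auto; lra.
    + replace s with (n1 + n2 + n4) in * by lra.
      apply (convex_comb3 C x1 x2 x4 z n1 n2 n4); auto; lra.
  - destruct Z4 as [-> | ->].
    + replace s with (p1 + p2 + p3) in * by lra.
      apply (convex_comb3 D x1 x2 x3 z p1 p2 p3); auto; lra.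
    + replace s with (n1 + n2 + n3) in * by lra.
      apply (convex_comb3 D x1 x2 x3 z n1 n2 n3); auto; lra.
Qed.

(** Intersecting all other members with [A] shortens the family; its triple intersections involve
    four sets and are supplied by [helly4]. *)
Lemma helly (L : list (pt -> Prop)) :
  (forall A, In A L -> convex A) ->
  (forall A B C, In A L -> In B L -> In C L -> exists x, A x /\ B x /\ C x) ->
  exists x, forall A, In A L -> A x.
Proof.
  remember (length L) as n eqn:Hn; revert L Hn.
  induction n as [|n IH]; intros [|A L] Hn HL H3; try discriminate.
  - exists (0, 0); simpl; tauto.
  - injection Hn as Hn.
    destruct L as [|B L].
    + destruct (H3 A A A) as (x & Hx & _); simpl; auto.
      exists x; intros C [<-|[]]; auto.
    + destruct (IH (map (fun C x => A x /\ C x) (B :: L))) as (x & Hx).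
      * now rewrite length_map.
      * intros D HD; apply in_map_iff in HD; destruct HD as (C & <- & HC).
        apply convex_inter; apply HL; simpl in *; tauto.
      * intros D1 D2 D3 K1 K2 K3; rewrite in_map_iff in K1, K2, K3.
        destruct K1 as (C1 & <- & K1), K2 as (C2 & <- & K2), K3 as (C3 & <- & K3).
        assert (KA : In A (A :: B :: L)) by (simpl; auto).
        apply (in_cons A) in K1, K2, K3.
        destruct (H3 C1 C2 C3 K1 K2 K3) as (x1 & X1).
        destruct (H3 A C2 C3 KA K2 K3) as (x2 & X2).
        destruct (H3 A C1 C3 KA K1 K3) as (x3 & X3).
        destruct (H3 A C1 C2 KA K1 K2) as (x4 & X4).
        destruct (helly4 A C1 C2 C3 x1 x2 x3 x4) as (z & Hz); auto.
        exists z; tauto.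
      * exists x; intros C HC.
        assert (HH : forall D, In D (B :: L) -> A x /\ D x).
        { intros D HD; apply (Hx (fun y => A y /\ D y)).
          apply in_map_iff; now exists D. }
        destruct HC as [<-|HC]; [apply (HH B); simpl; auto | now apply HH].
Qed.

(** The power of [x] with respect to the circle with centre [p] and squared radius [c]; it is at
    most 0 exactly on the disk when [c] is nonnegative. *)
Definition power (p : pt) (c : R) (x : pt) : R :=
  (fst x - fst p) ^ 2 + (snd x - snd p) ^ 2 - c.

Lemma convex_power p c : convex (fun x => power p c x <= 0).
Proof.
  intros x y t Ht Hx Hy; unfold power in *; simpl fst; simpl snd.
  assert (0 <= t * (1 - t) * ((fst x - fst y) ^ 2 + (snd x - snd y) ^ 2)).
  { apply Rmult_le_pos; [nra|]; apply Rplus_le_le_0_compat; apply pow2_ge_0. }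
  set (X := (fst x - fst p) ^ 2 + (snd x - snd p) ^ 2 - c) in *.
  set (Y := (fst y - fst p) ^ 2 + (snd y - snd p) ^ 2 - c) in *.
  replace (((1 - t) * fst x + t * fst y - fst p) ^ 2 +
     ((1 - t) * snd x + t * snd y - snd p) ^ 2 - c)
    with ((1 - t) * X + t * Y
      - t * (1 - t) * ((fst x - fst y) ^ 2 + (snd x - snd y) ^ 2))
    by (unfold X, Y; ring).
  nra.
Qed.

Definition midpoint (x y : pt) : pt := ((fst x + fst y) / 2, (snd x + snd y) / 2).

(* Strong convexity makes every minimising sequence Cauchy. *)
Lemma max_power_minimizer (I : list (pt * R)) : I <> [] ->
  exists x m, (forall i, In i I -> power (fst i) (snd i) x <= m) /\
    forall y, exists i, In i I /\ m <= power (fst i) (snd i) y.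
Proof.
  intros HI.
  set (h := fun (i : pt * R) x => power (fst i) (snd i) x).
  set (sub := fun m => exists x, forall i, In i I -> h i x <= m).
  (* Completeness provides suprema, so the infimum [m] is obtained by a change of sign. *)
  destruct (completeness (fun s => sub (- s))) as (s & Hub & Hlub).
  { destruct I as [|i0 I0]; [congruence|].
    exists (snd i0); intros s (x & Hx).
    specialize (Hx i0 (or_introl eq_refl)); unfold h, power in Hx.
    pose proof (pow2_ge_0 (fst x - fst (fst i0))).
    pose proof (pow2_ge_0 (snd x - snd (fst i0))); lra. }
  { destruct (exists_max (fun i => h i (0, 0)) I HI) as (i & _ & Hi).
    exists (- h i (0, 0)), (0, 0); now rewrite Ropp_involutive. }
  set (m := - s).
  assert (low : forall y, exists i, In i I /\ m <= h i y).
  { intros y; destruct (exists_max (fun i => h i y) I HI) as (i & Hi & Mi).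
    exists i; split; auto.
    specialize (Hub (- h i y)); unfold m.
    enough (- h i y <= s) by lra; apply Hub; exists y; now rewrite Ropp_involutive. }
  assert (app : forall n : nat, exists x, forall i, In i I -> h i x <= m + RinvN n).
  { intros n; apply NNPP; intros N.
    assert (K : is_upper_bound (fun s => sub (- s)) (s - RinvN n)).
    { intros s' (x & Hx); apply Rnot_lt_le; intros Hl; apply N; exists x.
      intros i Hi; specialize (Hx i Hi); unfold m; lra. }
    specialize (Hlub _ K); pose proof (cond_pos (RinvN n)); lra. }
  set (X := fun n => proj1_sig (constructive_indefinite_description _ (app n))).
  assert (HX : forall n i, In i I -> h i (X n) <= m + RinvN n)
    by (intros n; exact (proj2_sig (constructive_indefinite_description _ (app n)))).
  clearbody X.
  (* At a midpoint each power falls below the mean by a quarter of the squared distance, yet some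
     power there is at least [m]. *)
  assert (close : forall a b, (fst (X a) - fst (X b)) ^ 2 + (snd (X a) - snd (X b)) ^ 2
                    <= 2 * (RinvN a + RinvN b)).
  { intros a b; destruct (low (midpoint (X a) (X b))) as (i & Hi & Li).
    pose proof (HX a i Hi) as Ha; pose proof (HX b i Hi) as Hb.
    assert (E : h i (midpoint (X a) (X b)) = (h i (X a) + h i (X b)) / 2
      - ((fst (X a) - fst (X b)) ^ 2 + (snd (X a) - snd (X b)) ^ 2) / 4)
      by (unfold h, power, midpoint; simpl; field).
    lra. }
  assert (cauchy : forall f : pt -> R,
     (forall a b, (f (X a) - f (X b)) ^ 2 <= 2 * (RinvN a + RinvN b)) ->
     Cauchy_crit (fun n => f (X n))).
  { intros f Hf eps Heps.
    assert (Heps2 : eps ^ 2 / 4 > 0) by nra.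
    destruct (RinvN_cv Heps2) as (N & HN).
    exists N; intros a b Ha Hb.
    pose proof (HN a Ha) as Ea; pose proof (HN b Hb) as Eb.
    unfold Rdist in *; rewrite Rminus_0_r, Rabs_pos_eq in Ea, Eb
      by (apply Rlt_le, cond_pos).
    pose proof (Hf a b).
    apply Rabs_def1; nra. }
  destruct (R_complete (fun n => fst (X n))) as (x1 & Hx1).
  { apply cauchy; intros a b; specialize (close a b).
    pose proof (pow2_ge_0 (snd (X a) - snd (X b))); lra. }
  destruct (R_complete (fun n => snd (X n))) as (x2 & Hx2).
  { apply cauchy; intros a b; specialize (close a b).
    pose proof (pow2_ge_0 (fst (X a) - fst (X b))); lra. }
  exists (x1, x2), m; split; auto.
  intros i Hi; change (h i (x1, x2) <= m).
  assert (cst : forall c : R, Un_cv (fun _ => c) c).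
  { intros c eps Heps; exists 0%nat; intros; rewrite Rdist_eq; auto. }
  apply (Rle_cv_lim (Un := fun n => h i (X n)) (Vn := fun n => m + RinvN n)).
  - intros n; now apply HX.
  - unfold h, power; simpl fst; simpl snd.
    apply (CV_minus _ (fun _ => snd i)); [apply CV_plus|apply cst].
    + apply CV_mult; [|apply CV_mult; [|apply cst]];
        apply (CV_minus _ (fun _ => fst (fst i))); auto.
    + apply CV_mult; [|apply CV_mult; [|apply cst]];
        apply (CV_minus _ (fun _ => snd (fst i))); auto.
  - pose proof (CV_plus (fun _ => m) (fun n => RinvN n) m 0 (cst m) (@RinvN_cv)) as K.
    rewrite Rplus_0_r in K; exact K.
Qed.

Lemma near0_quadratic_neg a b c :
  a < 0 \/ (a = 0 /\ b < 0) -> near0 (fun t => a + b * t + c * t ^ 2 < 0).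
Proof.
  intros H; pose proof (Rle_abs b); pose proof (Rle_abs c).
  pose proof (Rabs_pos b); pose proof (Rabs_pos c).
  destruct H as [Ha|[-> Hb]].
  - assert (D : 0 < - a / (Rabs b + Rabs c + 1)) by (apply Rdiv_lt_0_compat; lra).
    exists (Rmin 1 (- a / (Rabs b + Rabs c + 1))); split; [apply Rmin_pos; lra|].
    intros t Ht.
    pose proof (Rmin_l 1 (- a / (Rabs b + Rabs c + 1))).
    pose proof (Rmin_r 1 (- a / (Rabs b + Rabs c + 1))).
    assert (t * (Rabs b + Rabs c + 1) < - a).
    { replace (- a) with (- a / (Rabs b + Rabs c + 1) * (Rabs b + Rabs c + 1))
        by (field; lra).
      apply Rmult_lt_compat_r; lra. }
    assert (b * t <= Rabs b * t) by (apply Rmult_le_compat_r; lra).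
    assert (c * t ^ 2 <= Rabs c * t).
    { apply Rle_trans with (Rabs c * t ^ 2); [apply Rmult_le_compat_r; nra|].
      apply Rmult_le_compat_l; nra. }
    lra.
  - assert (D : 0 < - b / (Rabs c + 1)) by (apply Rdiv_lt_0_compat; lra).
    exists (- b / (Rabs c + 1)); split; auto.
    intros t Ht.
    assert (t * (Rabs c + 1) < - b).
    { replace (- b) with (- b / (Rabs c + 1) * (Rabs c + 1)) by (field; lra).
      apply Rmult_lt_compat_r; lra. }
    replace (0 + b * t + c * t ^ 2) with (t * (b + c * t)) by ring.
    assert (c * t <= Rabs c * t) by (apply Rmult_le_compat_r; lra).
    assert (b + c * t < 0) by lra.
    nra.
Qed.

Definition dot (u v : pt) : R := fst u * fst v + snd u * snd v.
Definition vec (x p : pt) : pt := (fst p - fst x, snd p - snd x).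

Lemma power_step p c x w t :
  power p c (fst x + t * fst w, snd x + t * snd w) =
  power p c x + (- 2 * dot w (vec x p)) * t + dot w w * t ^ 2.
Proof. unfold power, dot, vec; simpl; ring. Qed.

(** Law of cosines with [r], [s] the distances to two centres and [d] the inner product: the cosine
    exceeds -1/2 because [r ^ 2 + s ^ 2 - 3/4 * (r + s) ^ 2] equals [(r - s) ^ 2 / 4 - r * s]. *)
Lemma dot_gt_of_pair_bound r s R1 R2 d :
  0 <= R1 < r -> 0 <= R2 < s ->
  r ^ 2 + s ^ 2 - 2 * d <= 3 / 4 * (R1 + R2) ^ 2 -> - (r * s) / 2 < d.
Proof.
  intros H1 H2 H.
  assert ((R1 + R2) ^ 2 < (r + s) ^ 2) by nra.
  pose proof (pow2_ge_0 (r - s)); nra.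
Qed.

(* At a minimiser of the largest power, the directions to the centres of the active
   disks make pairwise angles below 120 degrees if that power is positive; the sum w
   of at most three such unit vectors has positive inner product with each of them. *)
Lemma three_disks (p1 p2 p3 : pt) (R1 R2 R3 : R) :
  0 <= R1 -> 0 <= R2 -> 0 <= R3 ->
  edist p1 p2 ^ 2 <= 3 / 4 * (R1 + R2) ^ 2 ->
  edist p1 p3 ^ 2 <= 3 / 4 * (R1 + R3) ^ 2 ->
  edist p2 p3 ^ 2 <= 3 / 4 * (R2 + R3) ^ 2 ->
  exists x, power p1 (R1 ^ 2) x <= 0 /\ power p2 (R2 ^ 2) x <= 0 /\ power p3 (R3 ^ 2) x <= 0.
Proof.
  intros H1 H2 H3 H12 H13 H23.
  destruct (max_power_minimizer [(p1, R1 ^ 2); (p2, R2 ^ 2); (p3, R3 ^ 2)])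
    as (x & m & Hx & Hmin); [discriminate|].
  exists x.
  assert (M1 : power p1 (R1 ^ 2) x <= m) by (apply (Hx (p1, R1 ^ 2)); simpl; auto).
  assert (M2 : power p2 (R2 ^ 2) x <= m) by (apply (Hx (p2, R2 ^ 2)); simpl; auto).
  assert (M3 : power p3 (R3 ^ 2) x <= m) by (apply (Hx (p3, R3 ^ 2)); simpl; auto).
  destruct (Rle_lt_dec m 0) as [Hm|Hm]; [repeat split; lra|exfalso].
  assert (PE : forall p R, power p (R ^ 2) x = edist p x ^ 2 - R ^ 2).
  { intros p R; rewrite edist_sqr; unfold power; ring. }
  assert (DV : forall p q, 2 * dot (vec x p) (vec x q) =
    edist p x ^ 2 + edist q x ^ 2 - edist p q ^ 2).
  { intros p q; rewrite !edist_sqr; unfold dot, vec; simpl; ring. }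
  (* Normalises the direction to an active centre and discards inactive disks. *)
  set (k := fun p R => if Req_EM_T (power p (R ^ 2) x) m then / edist p x else 0).
  assert (act : forall p R, 0 <= R -> power p (R ^ 2) x = m -> R < edist p x).
  { intros p R HR E; rewrite PE in E.
    apply Rnot_le_lt; intros K; pose proof (edist_pos p x).
    assert (edist p x ^ 2 <= R ^ 2) by (apply pow_incr; lra); lra. }
  (* Two other centres together contribute more than [- edist p x], which the contribution of [p]
     itself compensates. *)
  assert (term : forall p q R R', 0 <= R -> 0 <= R' ->
     edist p q ^ 2 <= 3 / 4 * (R + R') ^ 2 -> power p (R ^ 2) x = m ->
     - edist p x / 2 < k q R' * dot (vec x p) (vec x q)).
  { intros p q R R' HR HR' Hpq E.
    pose proof (act p R HR E) as Kp.
    unfold k; destruct (Req_EM_T (power q (R' ^ 2) x) m) as [E'|E']; [|lra].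
    pose proof (act q R' HR' E') as Kq.
    assert (D : - (edist p x * edist q x) / 2 < dot (vec x p) (vec x q)).
    { apply (dot_gt_of_pair_bound _ _ R R'); try lra; rewrite DV; lra. }
    apply Rmult_lt_reg_l with (edist q x); [lra|].
    rewrite <- Rmult_assoc, Rinv_r by lra; lra. }
  assert (self : forall p R, 0 <= R -> power p (R ^ 2) x = m ->
     k p R * dot (vec x p) (vec x p) = edist p x).
  { intros p R HR E; pose proof (act p R HR E).
    unfold k; destruct (Req_EM_T (power p (R ^ 2) x) m) as [_|?]; [|tauto].
    replace (dot (vec x p) (vec x p)) with (edist p x * edist p x)
      by (pose proof (DV p p); rewrite edist_refl in *; lra).
    field; lra. }
  set (w := (k p1 R1 * fst (vec x p1) + k p2 R2 * fst (vec x p2) + k p3 R3 * fst (vec x p3),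
             k p1 R1 * snd (vec x p1) + k p2 R2 * snd (vec x p2) + k p3 R3 * snd (vec x p3)) : pt).
  assert (dotw : forall p, dot w (vec x p) = k p1 R1 * dot (vec x p) (vec x p1)
     + k p2 R2 * dot (vec x p) (vec x p2) + k p3 R3 * dot (vec x p) (vec x p3))
    by (intros p; unfold w, dot; simpl; ring).
  assert (dec : forall p R, power p (R ^ 2) x <= m ->
     (power p (R ^ 2) x = m -> 0 < dot w (vec x p)) ->
     near0 (fun t => power p (R ^ 2) (fst x + t * fst w, snd x + t * snd w) < m)).
  { intros p R Hp Hd.
    eapply near0_imp; [|apply (near0_quadratic_neg (power p (R ^ 2) x - m)
      (- 2 * dot w (vec x p)) (dot w w))].
    - intros t Ht; cbv beta in Ht |- *; rewrite power_step; lra.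
    - destruct (Req_dec (power p (R ^ 2) x) m) as [E|E]; [right | left; lra].
      specialize (Hd E); lra. }
  assert (N : near0 (fun t =>
    power p1 (R1 ^ 2) (fst x + t * fst w, snd x + t * snd w) < m /\
    power p2 (R2 ^ 2) (fst x + t * fst w, snd x + t * snd w) < m /\
    power p3 (R3 ^ 2) (fst x + t * fst w, snd x + t * snd w) < m)).
  { repeat apply near0_and; apply dec; auto; intros E; rewrite dotw.
    - rewrite (self _ _ H1 E).
      pose proof (term p1 p2 R1 R2 H1 H2 H12 E); pose proof (term p1 p3 R1 R3 H1 H3 H13 E); lra.
    - rewrite (self _ _ H2 E).
      rewrite (edist_sym p1 p2), (Rplus_comm R1 R2) in H12.
      pose proof (term p2 p1 R2 R1 H2 H1 H12 E); pose proof (term p2 p3 R2 R3 H2 H3 H23 E); lra.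
    - rewrite (self _ _ H3 E).
      rewrite (edist_sym p1 p3), (Rplus_comm R1 R3) in H13.
      rewrite (edist_sym p2 p3), (Rplus_comm R2 R3) in H23.
      pose proof (term p3 p1 R3 R1 H3 H1 H13 E); pose proof (term p3 p2 R3 R2 H3 H2 H23 E); lra. }
  destruct (near0_ex _ N) as (t & T1 & T2 & T3).
  destruct (Hmin (fst x + t * fst w, snd x + t * snd w)) as (i & Hi & Li).
  destruct Hi as [<-|[<-|[<-|[]]]]; cbn [fst snd] in Li; lra.
Qed.

(** Helly reduces the claim to three disks. The factor [2 / sqrt 3] has square 4/3, which cancels
    the 3/4 in the hypotheses of [three_disks]. *)
Lemma pairwise_meeting_disks {I} (c : I -> pt) (y : I -> R) (L : list I) :
  (forall i j, In i L -> In j L -> edist (c i) (c j) <= y i + y j) ->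
  exists o, forall i, In i L -> edist (c i) o <= 2 / sqrt 3 * y i.
Proof.
  intros H.
  assert (Hy : forall i, In i L -> 0 <= y i).
  (* A disk paired with itself shows that its radius is nonnegative. *)
  { intros i Hi; specialize (H i i Hi Hi); rewrite edist_refl in H; lra. }
  assert (S3 : 0 < sqrt 3) by (apply sqrt_lt_R0; lra).
  assert (L0 : 0 < 2 / sqrt 3) by (apply Rdiv_lt_0_compat; lra).
  assert (L2 : (2 / sqrt 3) ^ 2 = 4 / 3).
  { unfold Rdiv; rewrite Rpow_mult_distr, pow_inv, pow2_sqrt by lra; field. }
  set (la := 2 / sqrt 3) in *; clearbody la.
  set (disk := fun i x => power (c i) ((la * y i) ^ 2) x <= 0).
  destruct (helly (map disk L)) as (o & Ho).
  - intros A HA; apply in_map_iff in HA; destruct HA as (i & <- & _); apply convex_power.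
  - assert (B : forall i j, In i L -> In j L ->
      edist (c i) (c j) ^ 2 <= 3 / 4 * (la * y i + la * y j) ^ 2).
    { intros i j Hi Hj.
      replace (3 / 4 * (la * y i + la * y j) ^ 2) with (3 / 4 * la ^ 2 * (y i + y j) ^ 2) by ring.
      rewrite L2; replace (3 / 4 * (4 / 3)) with 1 by field; rewrite Rmult_1_l.
      apply pow_incr; split; [apply edist_pos | auto]. }
    intros A1 A2 A3 K1 K2 K3; rewrite in_map_iff in K1, K2, K3.
    destruct K1 as (i & <- & Hi), K2 as (j & <- & Hj), K3 as (k & <- & Hk).
    apply three_disks; auto; apply Rmult_le_pos; auto; lra.
  - exists o; intros i Hi.
    specialize (Ho (disk i) (in_map disk L i Hi)); unfold disk in Ho.
    apply Rsqr_incr_0_var; [|apply Rmult_le_pos; [lra | auto]].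
    rewrite !Rsqr_pow2, edist_sqr; unfold power in Ho.
    replace ((fst (c i) - fst o) ^ 2 + (snd (c i) - snd o) ^ 2)
      with ((fst o - fst (c i)) ^ 2 + (snd o - snd (c i)) ^ 2) by ring.
    lra.
Qed.

Theorem theorem1 :
  forall (n : nat) (S : list pt) (M : list (pt * pt)),
    (1 <= n)%nat ->
    NoDup S -> length S = (2 * n)%nat ->
    is_max_sum_matching S M ->
    exists o : pt, forall e, In e M ->
      edist (fst e) o + edist (snd e) o <= 2 / sqrt 3 * edist (fst e) (snd e).
Proof.
  intros n S M _ _ _ HM.
  destruct (max_sum_radii S M HM) as (y & Hedge & Hpair).
  destruct (pairwise_meeting_disks fst y (directed_edges M) Hpair) as (o & Ho).
  exists o; intros e He.
  assert (De : In e (directed_edges M)) by (apply in_app_iff; auto).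
  pose proof (Ho e De) as H1.
  (* The disk at the second end of [e] is the one labelled by [swap e]. *)
  pose proof (Ho (swap e) (in_directed_edges_swap M e De)) as H2; simpl in H2.
  rewrite <- (Hedge e He), Rmult_plus_distr_l; lra.
Qed.
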